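(* Let $A$ be a totally definite quaternion algebra over a number field $K$ and let $\Lambda$ be an $\mathcal{O}_K$-order of $A$. Suppose $\Lambda^1$ is isomorphic to an exceptional group (the binary tetrahedral, binary octahedral or binary icosahedral group). 1. If $[K:\mathbb{Q}]=1$, then $\Lambda^1$ contains a $\mathbb{Q}$-basis for $A$ if and only if $\Lambda^1$ is isomorphic to the binary tetrahedral group. 2. If $[K:\mathbb{Q}]=2$, then $\Lambda^1$ contains a $\mathbb{Q}$-basis for $A$ if and only if $\Lambda^1$ is isomorphic to the binary octahedral group or the binary icosahedral group. 3. If $[K:\mathbb{Q}]>2$, then $\Lambda^1$ does not contain a $\mathbb{Q}$-basis for $A$.
   Context: A quaternion algebra over a number field $K$ is $A=\left(\frac{a,b}{K}\right)=K\oplus Ki\oplus Kj\oplus Kij$ with $i^2=a$, $j^2=b$, $ij=-ji$, $a,b\in K^\times$. It is totally definite if $A\otimes_{\mathbb{Q}}\mathbb{R}\cong\mathbb{H}^n$, where $n=[K:\mathbb{Q}]$ and $\mathbb{H}$ denotes the Hamilton quaternions (then $K$ is totally real). For $x=x_0+x_1i+x_2j+x_3ij$, the conjugate is $\overline{x}=x_0-x_1i-x_2j-x_3ij$ and the reduced norm is $n_{A/K}(x)=x\overline{x}\in K$. $\mathcal{O}_K$ is the ring of integers of $K$. An $\mathcal{O}_K$-order $\Lambda$ of $A$ is a subring of $A$ containing $1$ that is a finitely generated $\mathcal{O}_K$-module containing a $K$-basis of $A$. Its reduced norm one group is $\Lambda^1=\{x\in\Lambda : n_{A/K}(x)=1\}$.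 The binary tetrahedral group (order 24), binary octahedral group (order 48) and binary icosahedral group (order 120) are $\langle x,y,z\mid x^2=y^3=z^c=xyz\rangle$ with $c=3,4,5$ respectively; these three are called the exceptional groups. *)

(* Defs.v *)
From HB Require Import structures.
From mathcomp Require Import all_boot all_order all_algebra all_fingroup.
From mathcomp Require Import all_solvable all_field ring.
From mathcomp Require Import classical_sets reals.

Set Implicit Arguments.
Unset Strict Implicit.
Unset Printing Implicit Defensive.

Import Order.TTheory GRing.Theory Num.Theory.
Local Open Scope ring_scope.

(* Quat x0 x1 x2 x3 stands for x0 + x1 i + x2 j + x3 ij. *)
Record quat (F : fieldType) (a b : F) :=
  Quat { q0 : F; q1 : F; q2 : F; q3 : F }.

Section QuaternionAlgebra.
Variables (F : fieldType) (a b : F).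
Local Notation A := (quat a b).

Definition quat_to (x : A) := (q0 x, q1 x, q2 x, q3 x).
Definition quat_of (t : F * F * F * F) : A :=
  let: (x0, x1, x2, x3) := t in Quat a b x0 x1 x2 x3.
Lemma quat_toK : cancel quat_to quat_of. Proof. by case. Qed.
HB.instance Definition _ := Choice.copy A (can_type quat_toK).

Definition quat_add (x y : A) : A :=
  Quat a b (q0 x + q0 y) (q1 x + q1 y) (q2 x + q2 y) (q3 x + q3 y).
Definition quat_opp (x : A) : A :=
  Quat a b (- q0 x) (- q1 x) (- q2 x) (- q3 x).

Fact quat_addA : associative quat_add.
Proof. by move=> x y z; rewrite /quat_add /= !addrA. Qed.
Fact quat_addC : commutative quat_add.
Proof.
by move=> x y; rewrite /quat_add; congr Quat; rewrite addrC.
Qed.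
Fact quat_add0 : left_id (Quat a b 0 0 0 0) quat_add.
Proof. by case=> *; rewrite /quat_add /= !add0r. Qed.
Fact quat_addN : left_inverse (Quat a b 0 0 0 0) quat_opp quat_add.
Proof. by case=> *; rewrite /quat_add /= !addNr. Qed.
HB.instance Definition _ :=
  GRing.isZmodule.Build A quat_addA quat_addC quat_add0 quat_addN.

(* The multiplication determined by i^2 = a, j^2 = b and ij = - ji; see
   quat_ii, quat_jj, quat_ij and quat_ji below. *)
Definition quat_mul (x y : A) : A :=
  Quat a b
    (q0 x * q0 y + a * q1 x * q1 y + b * q2 x * q2 y - a * b * q3 x * q3 y)
    (q0 x * q1 y + q1 x * q0 y - b * q2 x * q3 y + b * q3 x * q2 y)
    (q0 x * q2 y + q2 x * q0 y + a * q1 x * q3 y - a * q3 x * q1 y)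
    (q0 x * q3 y + q3 x * q0 y + q1 x * q2 y - q2 x * q1 y).

Fact quat_mulA : associative quat_mul.
Proof. by move=> x y z; rewrite /quat_mul /=; congr Quat; ring. Qed.
Fact quat_mul1l : left_id (Quat a b 1 0 0 0) quat_mul.
Proof. by case=> *; rewrite /quat_mul /=; congr Quat; ring. Qed.
Fact quat_mul1r : right_id (Quat a b 1 0 0 0) quat_mul.
Proof. by case=> *; rewrite /quat_mul /quat_add /=; congr Quat; ring. Qed.
Fact quat_mulDl : left_distributive quat_mul quat_add.
Proof. by move=> x y z; rewrite /quat_mul /quat_add /=; congr Quat; ring. Qed.
Fact quat_mulDr : right_distributive quat_mul quat_add.
Proof. by move=> x y z; rewrite /quat_mul /quat_add /=; congr Quat; ring. Qed.
Fact quat_oner_neq0 : Quat a b 1 0 0 0 != 0.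
Proof. by apply/eqP => -[] /eqP; rewrite oner_eq0. Qed.
HB.instance Definition _ := GRing.Zmodule_isNzRing.Build A
  quat_mulA quat_mul1l quat_mul1r quat_mulDl quat_mulDr quat_oner_neq0.

Definition quat_scale (c : F) (x : A) : A :=
  Quat a b (c * q0 x) (c * q1 x) (c * q2 x) (c * q3 x).
Fact quat_scaleA c d x : quat_scale c (quat_scale d x) = quat_scale (c * d) x.
Proof. by rewrite /quat_scale /= !mulrA. Qed.
Fact quat_scale1 : left_id 1 quat_scale.
Proof. by case=> *; rewrite /quat_scale /= !mul1r. Qed.
Fact quat_scaleDr : right_distributive quat_scale quat_add.
Proof. by move=> c x y; rewrite /quat_scale /quat_add /= !mulrDr. Qed.
Fact quat_scaleDl x c d :
  quat_scale (c + d) x = quat_add (quat_scale c x) (quat_scale d x).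
Proof. by rewrite /quat_scale /quat_add /= !mulrDl. Qed.
HB.instance Definition _ := GRing.Zmodule_isLmodule.Build F A
  quat_scaleA quat_scale1 quat_scaleDr quat_scaleDl.

Fact quat_scaleAl c (x y : A) : c *: (x * y) = (c *: x) * y.
Proof. by congr Quat => /=; ring. Qed.
HB.instance Definition _ := GRing.Lmodule_isLalgebra.Build F A quat_scaleAl.
Fact quat_scaleAr c (x y : A) : c *: (x * y) = x * (c *: y).
Proof. by congr Quat => /=; ring. Qed.
HB.instance Definition _ := GRing.Lalgebra_isAlgebra.Build F A quat_scaleAr.

Fact quat_hasFinDim : vector_axiom 4 A.
Proof.
exists (fun x : A => \row_(k < 4) nth 0 [:: q0 x; q1 x; q2 x; q3 x] k).
  move=> c x y; apply/rowP=> k; rewrite !mxE.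
  by case: k => [[|[|[|[|]]]]].
exists (fun v : 'rV[F]_4 => Quat a b (v 0 0) (v 0 1) (v 0 2%:R) (v 0 3%:R)).
  by case=> *; rewrite !mxE.
move=> v; apply/rowP=> k; rewrite !mxE.
by case: k => [[|[|[|[|]]]]] //= ?; congr (v _ _); apply: val_inj.
Qed.
HB.instance Definition _ := Lmodule_hasFinDim.Build F A quat_hasFinDim.
HB.instance Definition _ := Algebra_isFalgebra.Build F A.

Definition quat_i : A := Quat a b 0 1 0 0.
Definition quat_j : A := Quat a b 0 0 1 0.

Lemma quat_ii : quat_i * quat_i = a%:A.
Proof. by congr Quat => /=; ring. Qed.
Lemma quat_jj : quat_j * quat_j = b%:A.
Proof. by congr Quat => /=; ring. Qed.
Lemma quat_ij : quat_i * quat_j = Quat a b 0 0 0 1.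
Proof. by congr Quat => /=; ring. Qed.
Lemma quat_ji : quat_j * quat_i = - (quat_i * quat_j).
Proof. by congr Quat => /=; ring. Qed.

Definition quat_conj (x : A) : A := Quat a b (q0 x) (- q1 x) (- q2 x) (- q3 x).

(* The product of x and its conjugate lies in F (quat_nrdE), so that taking
   its first coordinate loses nothing. *)
Definition quat_nrd (x : A) : F := q0 (x * quat_conj x).

Lemma quat_nrdE x : x * quat_conj x = (quat_nrd x)%:A.
Proof. by congr Quat => /=; rewrite /quat_nrd /=; ring. Qed.

End QuaternionAlgebra.

(* The algebra A regarded as an algebra over the smaller field F0, as
   baseFieldType does for field extensions. *)
Section RestrictScalars.
Variables (F0 : fieldType) (F : fieldExtType F0) (A : falgType F).

Definition restrict_scalars : Type := A.
Local Notation A0 := restrict_scalars.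

HB.instance Definition _ := GRing.NzRing.on A0.

Definition restrict_scale (c : F0) (x : A0) : A0 := (c%:A : F) *: (x : A).
Fact restrict_scaleA c d x :
  restrict_scale c (restrict_scale d x) = restrict_scale (c * d) x.
Proof. by rewrite /restrict_scale scalerA -scalerAl mul1r scalerA. Qed.
Fact restrict_scale1 : left_id 1 restrict_scale.
Proof. by move=> x; rewrite /restrict_scale !scale1r. Qed.
Fact restrict_scaleDr : right_distributive restrict_scale +%R.
Proof. by move=> c x y; apply: scalerDr. Qed.
Fact restrict_scaleDl x : {morph restrict_scale^~ x : c d / c + d}.
Proof. by move=> c d; rewrite /restrict_scale !scalerDl. Qed.
HB.instance Definition _ := GRing.Zmodule_isLmodule.Build F0 A0
  restrict_scaleA restrict_scale1 restrict_scaleDr restrict_scaleDl.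

Fact restrict_scaleAl (c : F0) (x y : A0) : c *: (x * y) = (c *: x) * y.
Proof. exact: scalerAl. Qed.
HB.instance Definition _ :=
  GRing.Lmodule_isLalgebra.Build F0 A0 restrict_scaleAl.
Fact restrict_scaleAr (c : F0) (x y : A0) : c *: (x * y) = x * (c *: y).
Proof. exact: scalerAr. Qed.
HB.instance Definition _ :=
  GRing.Lalgebra_isAlgebra.Build F0 A0 restrict_scaleAr.

Fact restrict_hasFinDim : vector_axiom (\dim {:A} * \dim {:F})%N A0.
Proof.
pose bA := vbasis {:A}; set m := \dim {:A} in bA.
pose bF := vbasis {:F}; set n := \dim {:F} in bF.
pose v2r (x : A0) := mxvec (\matrix_(i, j) coord bF j (coord bA i (x : A))).
have v2r_lin: linear v2r.
  move=> c x y; rewrite -linearP; congr mxvec; apply/matrixP=> i j.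
  by rewrite !mxE linearP /= mulr_algl linearP.
pose r2v r : A :=
  \sum_(i < m) (\sum_(j < n) vec_mx r i j *: bF`_j) *: bA`_i.
exists v2r => //; exists r2v => [x | r].
  rewrite /r2v [RHS](coord_vbasis (memvf (x : A))); apply: eq_bigr => i _.
  congr (_ *: _); rewrite [RHS](coord_vbasis (memvf (coord bA i (x : A)))).
  by apply: eq_bigr => j _; rewrite mxvecK mxE.
apply: (canLR vec_mxK); apply/matrixP=> i j; rewrite mxE.
by rewrite !coord_sum_free ?(basis_free (vbasisP _)).
Qed.
HB.instance Definition _ :=
  Lmodule_hasFinDim.Build F0 A0 restrict_hasFinDim.
HB.instance Definition _ := Algebra_isFalgebra.Build F0 A0.

End RestrictScalars.

(* The L-algebra B (x)_F L, for L an extension of F via phi: the tensor e_k (x) t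
   of the k-th vector of the basis vbasis {:B} of B is the row with t in
   position k, and the product extends L-bilinearly the one of B. *)
Section BaseChange.
Variables (F L : fieldType).

(* phi is only used by the ring structure below. *)
Definition base_change (phi : {rmorphism F -> L}) (B : falgType F) : Type :=
  'rV[L]_(\dim {:B}).

Variables (phi : {rmorphism F -> L}) (B : falgType F).
Local Notation BL := (base_change phi B).
HB.instance Definition _ := GRing.Lmodule.on BL.

Definition base_change_in (x : B) : BL :=
  \row_k phi (coord (vbasis {:B}) k x).
Definition base_change_mul (u v : BL) : BL :=
  \sum_i \sum_j
    (u 0 i * v 0 j) *: base_change_in ((vbasis {:B})`_i * (vbasis {:B})`_j).

Local Notation "x ** y" := (base_change_mul x y) (at level 40).
Local Notation e := (vbasis {:B}).
Local Notation io := base_change_in.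

Fact base_change_in_sum I (r : seq I) (c : I -> F) (x : I -> B) :
  io (\sum_(i <- r) c i *: x i) = \sum_(i <- r) phi (c i) *: io (x i).
Proof.
apply/rowP=> k; rewrite mxE !summxE linear_sum rmorph_sum.
by apply: eq_bigr => i _; rewrite !mxE linearZ rmorphM.
Qed.

Fact base_change_row (u : BL) : u = \sum_i u 0 i *: io e`_i.
Proof.
apply/rowP=> k; rewrite summxE (bigD1 k) //= big1 => [|i nik].
  by rewrite !mxE coord_free ?(basis_free (vbasisP _)) // eqxx rmorph1 mulr1
    addr0.
rewrite !mxE coord_free ?(basis_free (vbasisP _)) //.
by move: nik; rewrite -val_eqE /= eq_sym => /negPf->; rewrite rmorph0 mulr0.
Qed.

Fact base_change_mulPl v : linear (base_change_mul^~ v).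
Proof.
move=> c u w; rewrite /base_change_mul scaler_sumr -big_split /=.
apply: eq_bigr => i _; rewrite scaler_sumr -big_split /=; apply: eq_bigr => j _.
by rewrite !mxE mulrDl scalerDl -mulrA scalerA.
Qed.

Fact base_change_mulPr v : linear (base_change_mul v).
Proof.
move=> c u w; rewrite /base_change_mul scaler_sumr -big_split /=.
apply: eq_bigr => i _; rewrite scaler_sumr -big_split /=; apply: eq_bigr => j _.
by rewrite !mxE mulrDr scalerDl mulrCA scalerA.
Qed.

Fact base_change_mul_suml I (r : seq I) (c : I -> L) (x : I -> BL) v :
  (\sum_(i <- r) c i *: x i) ** v = \sum_(i <- r) c i *: (x i ** v).
Proof.
elim: r => [|i r IH]; last by rewrite !big_cons base_change_mulPl IH.
rewrite !big_nil; have := base_change_mulPl v (-1) 0 0.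
by rewrite scaleN1r oppr0 addr0 scaleN1r addNr.
Qed.

Fact base_change_mul_sumr I (r : seq I) (c : I -> L) (x : I -> BL) v :
  v ** (\sum_(i <- r) c i *: x i) = \sum_(i <- r) c i *: (v ** x i).
Proof.
elim: r => [|i r IH]; last by rewrite !big_cons base_change_mulPr IH.
rewrite !big_nil; have := base_change_mulPr v (-1) 0 0.
by rewrite scaleN1r oppr0 addr0 scaleN1r addNr.
Qed.

Lemma base_change_inM x y : io (x * y) = io x ** io y.
Proof.
rewrite {1}(coord_vbasis (memvf x)) {1}(coord_vbasis (memvf y)) mulr_suml.
under eq_bigr => i _ do rewrite -scalerAl mulr_sumr.
rewrite base_change_in_sum; apply: eq_bigr => i _.
under eq_bigr => j _ do rewrite -scalerAr.
rewrite base_change_in_sum scaler_sumr; apply: eq_bigr => j _.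
by rewrite scalerA !mxE.
Qed.

Fact base_change_mulA : associative base_change_mul.
Proof.
move=> u v w; rewrite (base_change_row u) !base_change_mul_suml.
apply: eq_bigr => i _; congr (_ *: _).
rewrite (base_change_row v) !(base_change_mul_suml, base_change_mul_sumr).
apply: eq_bigr => j _; congr (_ *: _).
rewrite (base_change_row w) !base_change_mul_sumr.
apply: eq_bigr => k _; congr (_ *: _).
by rewrite -!base_change_inM mulrA.
Qed.

Fact base_change_mul1l : left_id (io 1) base_change_mul.
Proof.
move=> u; rewrite [in LHS](base_change_row u) base_change_mul_sumr.
rewrite [RHS]base_change_row; apply: eq_bigr => i _.
by rewrite -base_change_inM mul1r.
Qed.

Fact base_change_mul1r : right_id (io 1) base_change_mul.
Proof.
move=> u; rewrite [in LHS](base_change_row u) base_change_mul_suml.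
rewrite [RHS]base_change_row; apply: eq_bigr => i _.
by rewrite -base_change_inM mulr1.
Qed.

Fact base_change_mulDl : left_distributive base_change_mul +%R.
Proof.
by move=> u v w; have := base_change_mulPl w 1 u v; rewrite !scale1r.
Qed.

Fact base_change_mulDr : right_distributive base_change_mul +%R.
Proof.
by move=> u v w; have := base_change_mulPr u 1 v w; rewrite !scale1r.
Qed.

HB.instance Definition _ := GRing.Zmodule_isPzRing.Build BL
  base_change_mulA base_change_mul1l base_change_mul1r
  base_change_mulDl base_change_mulDr.

End BaseChange.
Arguments base_change {F L} phi B.

Section Orders.
Local Open Scope classical_set_scope.

Definition hamilton (R : realType) := quat (-1 : R) (-1 : R).

Definition totally_definite (R : realType) (K : fieldExtType rat) (a b : K) :=
  exists f : {linear base_change (@ratr R : {rmorphism rat -> R})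
                       (restrict_scalars (quat a b)) ->
                     {ffun 'I_(\dim {:K}) -> hamilton R}},
    bijective f /\ monoid_morphism f.

Definition ring_of_integers (K : fieldExtType rat) : set K :=
  [set x | integralOver (intr : int -> K) x].

Record is_order (K : fieldExtType rat) (a b : K) (Lam : set (quat a b)) :
    Prop := IsOrder {
  order1 : Lam 1;
  orderB : forall x y, Lam x -> Lam y -> Lam (x - y);
  orderM : forall x y, Lam x -> Lam y -> Lam (x * y);
  orderZ : forall c x, ring_of_integers c -> Lam x -> Lam (c *: x);
  order_fg : exists (m : nat) (g : 'I_m -> quat a b),
    (forall i, Lam (g i)) /\
    forall x, Lam x -> exists c : 'I_m -> K,
      (forall i, ring_of_integers (c i)) /\ x = \sum_i c i *: g i;
  order_basis : exists e : seq (quat a b),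
    basis_of {:quat a b} e /\ forall x, x \in e -> Lam x }.

Definition norm_one (K : fieldExtType rat) (a b : K) (Lam : set (quat a b)) :
  set (quat a b) := [set x | Lam x /\ quat_nrd x = 1].

Definition contains_Qbasis (K : fieldExtType rat) (a b : K)
    (S : set (quat a b)) :=
  exists e : seq (restrict_scalars (quat a b)),
    basis_of {:restrict_scalars (quat a b)} e /\ forall x, x \in e -> S x.

(* The multiplicatively closed set S is a group isomorphic to
   < x, y, z | x^2 = y^3 = z^c = xyz >.  The notation \isog Grp describes the
   largest finite quotient of a finitely presented group, which is the group
   itself for c = 3, 4, 5, where it is finite. *)
Definition isog_binary_polyhedral (c : nat) (A : nzRingType) (S : set A) :=
  exists (gT : finGroupType) (G : {group gT}) (f : gT -> A),
    [/\ (G \isog Grp (x : y : z :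
           (x ^+ 2 = x * y * z, y ^+ 3 = x * y * z, z ^+ c = x * y * z)))%g,
        {in G &, injective f},
        {in G &, {morph f : g h / (g * h)%g >-> g * h}} &
        [set f g | g in [set` G]] = S].

Definition isog_binary_tetrahedral := isog_binary_polyhedral 3.
Definition isog_binary_octahedral := isog_binary_polyhedral 4.
Definition isog_binary_icosahedral := isog_binary_polyhedral 5.

End Orders.

(* Main.v *)
From HB Require Import structures.
Require Import Defs.
From mathcomp Require Import all_boot all_order all_algebra all_fingroup.
From mathcomp Require Import all_solvable all_field ring.
From mathcomp Require Import classical_sets reals.
Set Implicit Arguments.
Unset Strict Implicit.
Unset Printing Implicit Defensive.

(* The relations x^2 = y^3 = z^c = xyz force x = yz, so the group is generated
   by y and z, which do not commute because the group has a noncommutative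
   polyhedral quotient. Hence x^2 centralizes A, lies in K, has norm 1, and
   must be -1. Comparing z^c = -1 with z^2 = tz - 1, where t = trd z, gives
   t = 1, t^2 = 2 or t^2 = t + 1 according to c = 3, 4, 5; likewise trd y = 1
   and trd (yz) = 0. The commutator of y and z then has norm 3 - t^2 <> 0, so
   1, y, z, yz is a K-basis of A, and multiplication by y and z preserves its
   L-span, L being the Q-span of 1 and t. Since tu = zu + z^-1 u, the Q-span
   of the group is exactly this L-span, so a Q-basis exists if and only if
   K = L. *)

Import Order.TTheory GRing.Theory Num.Theory.
Local Open Scope ring_scope.

(** * Binary polyhedral groups: generators, noncommutativity, induction on words *)

Section Groups.
Local Open Scope group_scope.

(** A list of values turns equality of permutations into a computation on sequences of naturals. *)
Definition tabulates n (s : seq nat) (p : 'S_n) :=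
  size s = n /\ forall i, p i = nth 0%N s i :> nat.

Lemma tabulates_ex n s : perm_eq s (iota 0 n) -> exists p : 'S_n, tabulates s p.
Proof.
case: n => [|n] s_iota; first exists 1.
  by split=> [|[]//]; rewrite (perm_size s_iota).
have sz : size s = n.+1 by rewrite (perm_size s_iota) size_iota.
have sE (i : 'I_n.+1) : (inord (nth 0%N s i) : 'I_n.+1) = nth 0%N s i :> nat.
  rewrite inordK //; suff: nth 0%N s i \in iota 0 n.+1 by rewrite mem_iota.
  by rewrite -(perm_mem s_iota) mem_nth ?sz.
have s_inj : injective (fun i : 'I_n.+1 => inord (nth 0%N s i) : 'I_n.+1).
  move=> i j /(congr1 val)/= /eqP; rewrite !sE.
  rewrite nth_uniq ?sz ?(perm_uniq s_iota) ?iota_uniq // => /eqP.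
  exact: val_inj.
by exists (perm s_inj); split=> // i; rewrite permE.
Qed.

Lemma tabulates1 n : tabulates (iota 0 n) (1 : 'S_n).
Proof. by split=> [|i]; rewrite ?size_iota // nth_iota // perm1. Qed.

Lemma tabulatesM n s t (p q : 'S_n) :
  tabulates s p -> tabulates t q ->
  tabulates [seq nth 0%N t k | k <- s] (p * q).
Proof.
move=> [sz ps] [_ qt]; split=> [|i]; first by rewrite size_map.
by rewrite permM qt ps (nth_map 0%N) ?sz.
Qed.

Lemma tabulatesX n s (p : 'S_n) m : tabulates s p ->
  tabulates (iter m (fun t => [seq nth 0%N t k | k <- s]) (iota 0 n)) (p ^+ m).
Proof.
move=> ps; elim: m => [|m IH]; first exact: tabulates1.
by rewrite expgS; apply: tabulatesM.
Qed.

Lemma tabulates_eq n s t (p q : 'S_n) :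
  tabulates s p -> tabulates t q -> (p == q) = (s == t).
Proof.
move=> [szs ps] [szt qt]; apply/eqP/eqP=> [pq | st].
  apply: (@eq_from_nth _ 0%N) => [|i]; rewrite szs ?szt // => lti.
  by rewrite -(ps (Ordinal lti)) pq qt.
by apply/permP=> i; apply: val_inj; rewrite /= ps st qt.
Qed.

(* In A4, S4 and A5: rotations of order 3 and c of the tetrahedron, cube and
   icosahedron whose product is a half-turn. *)
Lemma noncommuting_rotations (c : nat) : c \in [:: 3; 4; 5] ->
  exists y z : 'S_5,
    [/\ (y * z) ^+ 2 = 1, y ^+ 3 = 1, z ^+ c = 1 & y * z != z * y].
Proof.
have [y yE] := @tabulates_ex 5 [:: 1; 2; 0; 3; 4]%N isT.
suff wit (s : seq nat) : perm_eq s (iota 0 5) ->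
  (forall z : 'S_5, tabulates s z ->
    [&& (y * z) ^+ 2 == 1, y ^+ 3 == 1, z ^+ c == 1 & y * z != z * y]) ->
  exists y z : 'S_5,
    [/\ (y * z) ^+ 2 = 1, y ^+ 3 = 1, z ^+ c = 1 & y * z != z * y].
  (* With [y] the cycle (0 1 2), the lists below are (0 1 3), (0 2 1 3) and (0 2 4 1 3); the
     product, [y] applied first, is (0 3)(1 2), (0 3) and (0 3)(1 4) respectively. *)
  rewrite !inE => /or3P[]/eqP cE;
    [ apply: (wit [:: 1; 3; 2; 0; 4]%N) | apply: (wit [:: 2; 3; 1; 0; 4]%N)
    | apply: (wit [:: 2; 3; 4; 0; 1]%N) ] => // z zE;
    rewrite cE (tabulates_eq (tabulatesX 2 (tabulatesM yE zE)) (tabulates1 5))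
      (tabulates_eq (tabulatesX 3 yE) (tabulates1 5))
      (tabulates_eq (tabulatesX _ zE) (tabulates1 5))
      (tabulates_eq (tabulatesM yE zE) (tabulatesM zE yE)) //.
move=> s_iota h; have [z zE] := tabulates_ex s_iota.
by have /and4P[/eqP ? /eqP ? /eqP ? ?] := h z zE; exists y, z.
Qed.

(** Reduces the isomorphism to two noncommuting elements and an induction principle on words in
    them. As [f] is only multiplicative, [f 1] is a priori just an idempotent, hence the assumption
    on idempotents. *)
Lemma isog_binary_polyhedralP (c : nat) (A : nzRingType) (S : set A) :
  c \in [:: 3; 4; 5] -> (forall e, S e -> (e * e)%R = e -> e = 1%R) ->
  isog_binary_polyhedral c S ->
  exists y z : A,
    [/\ [/\ (y ^+ 3 = (y * z) ^+ 2)%R, (z ^+ c = (y * z) ^+ 2)%R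
          & (y * z != z * y)%R],
        [/\ S 1%R, S y, S z & forall v w, S v -> S w -> S (v * w)%R],
        (forall v, S v -> exists2 w, S w & (v * w = 1)%R) &
        (forall P : A -> Prop, P 1%R -> (forall v, P v -> P (y * v)%R) ->
           (forall v, P v -> P (z * v)%R) -> forall v, S v -> P v)].
Proof.
move=> hc S_idem [gT [G [f [isoG f_inj fM imf]]]].
have := isoGrp_hom isoG; rewrite /Presentation.hom /=.
case/existsP=> -[[x y] z] /=; rewrite !xpair_eqE => /andP[/eqP GE] /= /and3P[].
move=> /eqP x2 /eqP y3 /eqP zc.
have xE : x = y * z by apply: (mulgI x); rewrite mulgA -x2.
have G_yz : G :=: <<[set y; z]>>.
  rewrite -GE; apply/eqP; rewrite finset.eqEsubset !join_subG !cycle_subG xE.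
  rewrite groupM ?mem_gen ?finset.set21 ?finset.set22 //= !finset.sub1set.
  by rewrite (fintype.subsetP (joing_subl _ _))
      ?(fintype.subsetP (joing_subr _ _)) ?cycle_id.
have Gy : y \in G by rewrite G_yz mem_gen ?finset.set21.
have Gz : z \in G by rewrite G_yz mem_gen ?finset.set22.
have yzC : y * z != z * y.
  apply/eqP => yzC.
  have [t [u [tu2 t3 uc tuC]]] := noncommuting_rotations hc.
  (* The presented group maps onto every finite group generated by elements satisfying its
     relations; for [t * u], [t], [u] all of x^2, y^3, z^c and xyz become 1. *)
  have: <<[set t * u]>> <*> <<[set t]>> <*> <<[set u]>> \homg G.
    rewrite isoG; apply/existsP; exists (t * u, t, u) => /=.
    rewrite !xpair_eqE -[_ * _ * t * u]mulgA -(expgS _ 1) tu2 t3 uc.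
    by rewrite !eqxx.
  case/homgP => h hG; case/eqP: tuC.
  have : abelian (<<[set t * u]>> <*> <<[set t]>> <*> <<[set u]>>).
    rewrite -hG morphim_abelian // G_yz abelian_gen.
    by apply/centsP=> ? /finset.set2P[]-> ? /finset.set2P[]->.
  move/centsP; apply.
    by rewrite (fintype.subsetP (joing_subl _ _))
      ?(fintype.subsetP (joing_subr _ _)) ?cycle_id.
  by rewrite (fintype.subsetP (joing_subr _ _)) ?cycle_id.
have Sf g : g \in G -> S (f g) by move=> Gg; rewrite -imf; exists g.
have fS v : S v -> exists2 g, g \in G & f g = v.
  by rewrite -imf => -[g Gg <-]; exists g.
have f1 : f 1 = 1%R by apply: S_idem; [apply: Sf | rewrite -fM // mulg1].
have fX g n : g \in G -> f (g ^+ n) = (f g ^+ n)%R.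
  move=> Gg; elim: n => [|n IH]; first by rewrite f1.
  by rewrite expgS exprS fM ?groupX // IH.
exists (f y), (f z); split.
- rewrite -!fM // -!fX ?groupM // y3 zc -x2 xE; split=> //.
  by apply: contra yzC => /eqP/f_inj-> //; rewrite groupM.
- split; rewrite -?f1; do ?exact: Sf.
  move=> v w /fS[g Gg <-] /fS[h Gh <-].
  by rewrite -fM //; apply: Sf; rewrite groupM.
- move=> v /fS[g Gg <-]; exists (f g^-1); first by apply: Sf; rewrite groupV.
  by rewrite -fM ?groupV // mulgV.
move=> P P1 Py Pz v /fS[g Gg <-].
(* In a finite group, words in the generators need no inverses. *)
have /gen_prodgP[n [k k_yz ->]] : g \in <<[set y; z]>> by rewrite -G_yz.
have kG i : k i \in G by rewrite G_yz mem_gen.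
elim: n k k_yz kG => [|n IH] k k_yz kG; first by rewrite big_ord0 f1.
rewrite big_ord_recl fM ?group_prod //.
by case/finset.set2P: (k_yz ord0) => ->; [apply: Py | apply: Pz]; apply: IH.
Qed.
End Groups.

(** * Quaternion identities, centralizers and traces of the generators *)

Section Quaternions.
Variables (F : fieldType) (a b : F).
Implicit Types v w y z : quat a b.

Definition quat_trd v : F := q0 v + q0 v.

Lemma quat_eqP v w :
  q0 v = q0 w -> q1 v = q1 w -> q2 v = q2 w -> q3 v = q3 w -> v = w.
Proof. by case: v; case: w => /= ? ? ? ? ? ? ? ? -> -> -> ->. Qed.

Lemma quat_nrdM v w : quat_nrd (v * w) = quat_nrd v * quat_nrd w.
Proof. by rewrite /quat_nrd /=; ring. Qed.

Lemma quat_nrd_scalar c : quat_nrd (c%:A : quat a b) = c ^+ 2.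
Proof. by rewrite /quat_nrd /=; ring. Qed.

Lemma quat_sqr v : v ^+ 2 = quat_trd v *: v - (quat_nrd v)%:A.
Proof. by rewrite expr2 /quat_trd /quat_nrd; apply: quat_eqP => /=; ring. Qed.

Lemma quat_trd_conj v : v + quat_conj v = (quat_trd v)%:A.
Proof. by rewrite /quat_trd; apply: quat_eqP => /=; ring. Qed.

Lemma quat_conj_mul v : quat_conj v * v = (quat_nrd v)%:A.
Proof. by rewrite /quat_nrd; apply: quat_eqP => /=; ring. Qed.

(** For norms 1 this is the Fricke identity: the value is 2 minus the trace of the group
    commutator. *)
Lemma quat_nrd_comm y z :
  quat_nrd (y * z - z * y) =
  4%:R * quat_nrd y * quat_nrd z + quat_trd y * quat_trd z * quat_trd (y * z)
  - quat_trd y ^+ 2 * quat_nrd z - quat_trd z ^+ 2 * quat_nrd y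
  - quat_trd (y * z) ^+ 2.
Proof. by rewrite /quat_trd /quat_nrd /=; ring. Qed.

Definition quat_comb y z (l0 l1 l2 l3 : F) : quat a b :=
  l0%:A + l1 *: y + l2 *: z + l3 *: (y * z).

Lemma quat_mul_comb1 y z l0 l1 l2 l3 :
  y * quat_comb y z l0 l1 l2 l3 =
  quat_comb y z (- (quat_nrd y * l1)) (l0 + quat_trd y * l1)
    (- (quat_nrd y * l3)) (l2 + quat_trd y * l3).
Proof. by rewrite /quat_trd /quat_nrd; apply: quat_eqP => /=; ring. Qed.

(** Polarizing [quat_sqr] gives zy = trd(y) z + trd(z) y - yz - (trd(y) trd(z) - trd(yz)), which
    brings every product back to 1, y, z, yz. *)
Lemma quat_mul_comb2 y z l0 l1 l2 l3 :
  z * quat_comb y z l0 l1 l2 l3 =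
  quat_comb y z
    (- ((quat_trd y * quat_trd z - quat_trd (y * z)) * l1)
     - quat_nrd z * l2 - quat_nrd z * quat_trd y * l3)
    (quat_trd z * l1 + quat_nrd z * l3)
    (l0 + quat_trd y * l1 + quat_trd z * l2 + quat_trd (y * z) * l3)
    (- l1).
Proof. by rewrite /quat_trd /quat_nrd; apply: quat_eqP => /=; ring. Qed.

(** The commutator c is trace-orthogonal to 1, y and z, so the trace against c isolates [l3];
    bracketing with z then leaves [l1] c, and with y leaves [l2] c. *)
Lemma quat_comb_inj0 y z l0 l1 l2 l3 : quat_nrd (y * z - z * y) != 0 ->
  quat_comb y z l0 l1 l2 l3 = 0 -> [/\ l0 = 0, l1 = 0, l2 = 0 & l3 = 0].
Proof.
set c := y * z - z * y => c_neq0 v0.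
have : quat_trd (c * quat_comb y z l0 l1 l2 l3) = - (l3 * quat_nrd c).
  by rewrite /quat_trd /quat_nrd /=; ring.
rewrite v0 mulr0 /quat_trd /= addr0 => /esym/eqP.
rewrite oppr_eq0 mulf_eq0 (negPf c_neq0) orbF => /eqP l30.
have c0 l : l *: c = 0 -> l = 0.
  move=> /eqP; rewrite scaler_eq0 => /orP[/eqP//|/eqP c0].
  by rewrite c0 /quat_nrd mul0r /= eqxx in c_neq0.
move: v0; rewrite l30 => v0.
have l10 : l1 = 0.
  apply: c0; transitivity (quat_comb y z l0 l1 l2 0 * z
    - z * quat_comb y z l0 l1 l2 0).
    by apply: quat_eqP => /=; ring.
  by rewrite v0 mul0r mulr0 subr0.
have l20 : l2 = 0.
  apply: c0; transitivity (y * quat_comb y z l0 l1 l2 0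
    - quat_comb y z l0 l1 l2 0 * y).
    by apply: quat_eqP => /=; ring.
  by rewrite v0 mul0r mulr0 subr0.
move: v0; rewrite /quat_comb l10 l20 !scale0r !addr0 => /eqP.
by rewrite scaler_eq0 oner_eq0 orbF => /eqP.
Qed.

Lemma quat_comb_onto y z v : quat_nrd (y * z - z * y) != 0 ->
  exists l0 l1 l2 l3, v = quat_comb y z l0 l1 l2 l3.
Proof.
move=> c_neq0; pose X := [tuple of [:: 1; y; z; y * z]].
have Xfree : free X.
  apply/freeP => k; rewrite !big_ord_recl big_ord0 /= addr0 !addrA.
  case/(quat_comb_inj0 c_neq0) => k0 k1 k2 k3 [[|[|[|[|]]]] //= lt].
  - by rewrite -[RHS]k0; congr k; apply: val_inj.
  - by rewrite -[RHS]k1; congr k; apply: val_inj.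
  - by rewrite -[RHS]k2; congr k; apply: val_inj.
  - by rewrite -[RHS]k3; congr k; apply: val_inj.
have Xbasis : basis_of fullv X.
  by rewrite basisEfree Xfree subvf dimvf.
rewrite (coord_basis Xbasis (memvf v)) !big_ord_recl big_ord0 /= addr0 !addrA.
by do 4!eexists; reflexivity.
Qed.

Hypotheses (two_neq0 : (2%:R : F) != 0) (a_neq0 : a != 0) (b_neq0 : b != 0).

(** If [w1] is nonzero, the vectors y and z are both multiples of w, so their cross product
    vanishes. Cyclic shifts of the indices give the other coordinates of w. *)
Let cross_eq0 (w1 w2 w3 y1 y2 y3 z1 z2 z3 : F) :
    w2 * y3 = w3 * y2 -> w3 * y1 = w1 * y3 -> w1 * y2 = w2 * y1 ->
    w2 * z3 = w3 * z2 -> w3 * z1 = w1 * z3 -> w1 * z2 = w2 * z1 ->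
  [|| y2 * z3 != y3 * z2, y3 * z1 != y1 * z3 | y1 * z2 != y2 * z1] -> w1 = 0.
Proof.
move=> y23 y31 y12 z23 z31 z12; rewrite -!(subr_eq0 (_ * _)).
have [//|w1_neq0] := eqVneq w1 0.
have w1d d : w1 * d = 0 -> d = 0.
  by move/eqP; rewrite mulf_eq0 (negPf w1_neq0) => /eqP.
have -> : y2 * z3 - y3 * z2 = 0.
  apply: w1d; transitivity (y1 * (w2 * z3) - z2 * (w1 * y3)
    + z3 * (w1 * y2 - w2 * y1)); first by ring.
  by rewrite -y31 y12 z23; ring.
have -> : y3 * z1 - y1 * z3 = 0.
  apply: w1d; transitivity ((w1 * y3) * z1 - y1 * (w1 * z3)); first by ring.
  by rewrite -y31 -z31; ring.
have -> : y1 * z2 - y2 * z1 = 0.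
  apply: w1d; transitivity (y1 * (w1 * z2) - (w1 * y2) * z1); first by ring.
  by rewrite y12 z12; ring.
by rewrite eqxx.
Qed.

(** Up to sign and the nonzero factors 2b, 2a and 2, the commutator is the cross product of the
    imaginary parts. *)
Lemma quat_commute v w : v * w = w * v <->
  [/\ q2 v * q3 w = q3 v * q2 w, q3 v * q1 w = q1 v * q3 w
    & q1 v * q2 w = q2 v * q1 w].
Proof.
split=> [vw|[c1 c2 c3]]; last first.
  apply/eqP; rewrite -subr_eq0; apply/eqP.
  transitivity (Quat a b 0 (2%:R * b * (q3 v * q2 w - q2 v * q3 w))
    (2%:R * a * (q1 v * q3 w - q3 v * q1 w))
    (2%:R * (q1 v * q2 w - q2 v * q1 w))).
    by apply: quat_eqP => /=; ring.
  by rewrite c1 c2 c3 !subrr !mulr0.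
split; apply/eqP; rewrite -subr_eq0.
- have : 2%:R * b * (q2 v * q3 w - q3 v * q2 w) = q1 (w * v - v * w).
    by rewrite /=; ring.
  rewrite vw subrr /= => /eqP.
  by rewrite !mulf_eq0 (negPf two_neq0) (negPf b_neq0).
- have : 2%:R * a * (q3 v * q1 w - q1 v * q3 w) = q2 (w * v - v * w).
    by rewrite /=; ring.
  rewrite vw subrr /= => /eqP.
  by rewrite !mulf_eq0 (negPf two_neq0) (negPf a_neq0).
- have : 2%:R * (q1 v * q2 w - q2 v * q1 w) = q3 (v * w - w * v).
    by rewrite /=; ring.
  rewrite vw subrr /= => /eqP.
  by rewrite !mulf_eq0 (negPf two_neq0).
Qed.

Lemma quat_centralizer y z w : y * z != z * y ->
  w * y = y * w -> w * z = z * w -> w = (q0 w)%:A.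
Proof.
move=> yzC /quat_commute[y1 y2 y3] /quat_commute[z1 z2 z3].
have yz : [|| q2 y * q3 z != q3 y * q2 z, q3 y * q1 z != q1 y * q3 z
            | q1 y * q2 z != q2 y * q1 z].
  apply: contraR yzC; rewrite !negb_or !negbK => /and3P[/eqP ? /eqP ? /eqP ?].
  by apply/eqP/quat_commute.
apply: quat_eqP => /=; rewrite ?mulr1 ?mulr0 //.
- exact: (cross_eq0 y1 y2 y3 z1 z2 z3).
- by apply: (cross_eq0 y2 y3 y1 z2 z3 z1); case/or3P: yz => ->; rewrite ?orbT.
- by apply: (cross_eq0 y3 y1 y2 z3 z1 z2); case/or3P: yz => ->; rewrite ?orbT.
Qed.

(** Bracketing with z kills the scalar side and leaves [al] (yz - zy) = 0. *)
Lemma quat_noncomm_scalar y z (al be : F) : y * z != z * y ->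
  al *: y = be%:A -> al = 0 /\ be = 0.
Proof.
move=> yzC ay; suff al0 : al = 0.
  split=> //; move/eqP: ay; rewrite al0 scale0r eq_sym scaler_eq0 oner_eq0 orbF.
  by move/eqP.
have : al *: (y * z - z * y) = 0.
  rewrite scalerBr scalerAl scalerAr ay -scalerAl -scalerAr mul1r mulr1.
  exact: subrr.
by move/eqP; rewrite scaler_eq0 subr_eq0 (negPf yzC) orbF => /eqP.
Qed.

(** Chebyshev recurrence: it makes the coefficients of the powers of v polynomials in the trace. *)
Lemma quat_expS n v (al be : F) : quat_nrd v = 1 ->
  v ^+ n = al *: v - be%:A ->
  v ^+ n.+1 = (al * quat_trd v - be) *: v - al%:A.
Proof.
move=> v1 vn; rewrite exprSr vn mulrBl -!scalerAl mul1r -expr2 quat_sqr v1.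
by rewrite scale1r scalerBr scalerA scalerBl addrAC.
Qed.

Lemma polyhedral_traces c y z : c \in [:: 3; 4; 5] ->
  quat_nrd y = 1 -> quat_nrd z = 1 -> y * z != z * y ->
  y ^+ 3 = (y * z) ^+ 2 -> z ^+ c = (y * z) ^+ 2 ->
  [/\ quat_trd (y * z) = 0, quat_trd y = 1 &
      if c == 3 then quat_trd z = 1 else
      if c == 4 then quat_trd z ^+ 2 = 2%:R else
      quat_trd z ^+ 2 = quat_trd z + 1].
Proof.
move=> hc y1 z1 yzC y3 zc; set w := (y * z) ^+ 2 in y3 zc.
have yz1 : quat_nrd (y * z) = 1 by rewrite quat_nrdM y1 z1 mulr1.
have w1 : quat_nrd w = 1 by rewrite /w expr2 quat_nrdM yz1 mulr1.
have zyC : z * y != y * z by rewrite eq_sym.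
have yzyC : (y * z) * y != y * (y * z).
  apply: contra yzC => /eqP yzy; apply/eqP.
  have := congr1 ( *%R (quat_conj y)) yzy.
  by rewrite !mulrA quat_conj_mul y1 scale1r !mul1r => ->.
(* Being a power of y and a power of z, [w] commutes with both. *)
have wE : w = (q0 w)%:A.
  apply: (quat_centralizer yzC).
  - by rewrite -y3 -exprSr exprS.
  - by rewrite -zc -exprSr exprS.
have wN1 : w = - 1.
  have : (q0 w) ^+ 2 == 1 by rewrite -quat_nrd_scalar -wE w1.
  rewrite sqrf_eq1 => /orP[]/eqP q0w; last by rewrite wE q0w scaleN1r.
  (* If [w] were 1, then trd(yz) yz = 2 with yz noncentral, forcing 2 = 0. *)
  have := quat_sqr (y * z); rewrite -/w wE yz1 q0w => /eqP.
  rewrite eq_sym subr_eq -scalerDl => /eqP /(quat_noncomm_scalar yzyC)[_].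
  by move=> /eqP; rewrite (negPf two_neq0).
have sq v : quat_nrd v = 1 -> v ^+ 2 = quat_trd v *: v - 1%:A.
  by move=> v1; rewrite quat_sqr v1.
have pw v u n (al be : F) : v * u != u * v -> v ^+ n = w ->
    v ^+ n = al *: v - be%:A -> al = 0 /\ be = 1.
  move=> vuC -> wE'; have : al *: v = (be - 1)%:A.
    by apply/eqP; rewrite scalerBl scale1r addrC -subr_eq -wE' wN1.
  by move=> /(quat_noncomm_scalar vuC)[-> /eqP]; rewrite subr_eq0 => /eqP.
have [tyz _] := pw _ _ _ _ _ yzyC (erefl w) (sq _ yz1).
have [ty21 ty] := pw _ _ _ _ _ yzC y3 (quat_expS y1 (sq _ y1)).
split=> //.
have z2 := sq _ z1; have z3 := quat_expS z1 z2; have z4 := quat_expS z1 z3.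
have z5 := quat_expS z1 z4.
move: hc zc; rewrite !inE => /or3P[]/eqP-> /= zc.
- by have [_] := pw _ _ _ _ _ zyC zc z3.
- have [_ /eqP] := pw _ _ _ _ _ zyC zc z4.
  by rewrite subr_eq -expr2 => /eqP.
(* For z^5, [be] is t^3 - 2t and [al] is [be] t - (t^2 - 1); since [be] is 1, the vanishing of [al]
   reads t^2 = t + 1. *)
- have [+ be1] := pw _ _ _ _ _ zyC zc z5; rewrite be1 mul1r => /eqP.
  by rewrite subr_eq0 eq_sym subr_eq -expr2 => /eqP.
Qed.

Lemma polyhedral_commutator c y z : c \in [:: 3; 4; 5] ->
  quat_nrd y = 1 -> quat_nrd z = 1 -> y * z != z * y ->
  y ^+ 3 = (y * z) ^+ 2 -> z ^+ c = (y * z) ^+ 2 ->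
  quat_nrd (y * z - z * y) != 0.
Proof.
move=> hc y1 z1 yzC y3 zc.
have [tyz ty tz] := polyhedral_traces hc y1 z1 yzC y3 zc.
rewrite quat_nrd_comm y1 z1 tyz ty; move: tz.
set t := quat_trd z.
rewrite (_ : _ - _ = 3%:R - t ^+ 2); last by ring.
case: ifP => _ tz.
  by rewrite tz (_ : _ - _ = 2%:R) //; ring.
move: tz; case: ifP => _ tz.
  by rewrite tz (_ : _ - _ = 1) ?oner_neq0 //; ring.
rewrite tz (_ : _ - _ = 2%:R - t); last by ring.
(* The value t = 2 would turn t^2 = t + 1 into 4 = 3. *)
apply: contraTneq isT => /eqP; rewrite subr_eq0 => /eqP t2.
have : 1 = t ^+ 2 - (t + 1) by rewrite -t2; ring.
by rewrite tz subrr => /eqP; rewrite oner_eq0.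
Qed.
End Quaternions.

(** * Extraction of bases and irrationality of square roots of primes *)

Lemma span_free_seq (F : fieldType) (V : vectType F) (s : seq V) :
  exists e : seq V, [/\ {subset e <= s}, free e & (<<e>> = <<s>>)%VS].
Proof.
elim: s => [|v s [e [es e_free e_span]]].
  by exists [::]; rewrite nil_free.
have [ve|ve] := boolP (v \in <<e>>%VS).
  exists e; split=> // [w /es ws|]; first by rewrite inE ws orbT.
  by rewrite span_cons -e_span; apply/esym/addv_idPr; rewrite -memvE.
exists (v :: e); split; last by rewrite !span_cons e_span.
  by move=> w; rewrite !inE => /predU1P[->|/es->]; rewrite ?eqxx ?orbT.
by rewrite free_cons ve.
Qed.

(** Parity of the p-adic valuation: even for n^2, odd for p d^2. *)
Lemma rat_sqr_neq_prime p (r : rat) : prime p -> r ^+ 2 != p%:R.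
Proof.
move=> p_pr; apply/eqP => r2; pose n := `|numq r|%N; pose d := `|denq r|%N.
have d_gt0 : (0 < d)%N by rewrite absz_gt0 denq_neq0.
have n2 : (n ^ 2 = p * d ^ 2)%N.
  suff : numq r ^+ 2 = p%:Z * denq r ^+ 2.
    by move/(congr1 absz); rewrite abszM !abszX.
  by apply: (@intr_inj rat); rewrite [RHS]rmorphM !rmorphXn /= numqE exprMn r2.
have := congr1 (logn p) n2; rewrite lognM ?(prime_gt0 p_pr) ?expn_gt0 ?d_gt0 //.
rewrite !lognX [logn p p]logn_prime // eqxx => /(congr1 odd).
by rewrite oddD !oddM.
Qed.

(** * The rational space L + Ly + Lz + Lyz and the span of the group *)

Section RationalSpan.
Variables (K : fieldExtType rat) (a b : K).
Local Notation A := (quat a b).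
Local Notation A0 := (restrict_scalars A).
Implicit Types (u v w y z : A) (L : {vspace K}).

Definition line_map u (l : K) : A0 := l *: u.
Fact line_map_linear u : linear (line_map u).
Proof.
by move=> c l m; rewrite /line_map scalerDl -[c *: l]mulr_algl -scalerA.
Qed.
HB.instance Definition _ u :=
  GRing.isLinear.Build rat K A0 _ (line_map u) (line_map_linear u).

Definition comb_space L y z : {vspace A0} :=
  (linfun (line_map 1%R) @: L + linfun (line_map y) @: L
   + linfun (line_map z) @: L + linfun (line_map (y * z)) @: L)%VS.

Lemma comb_spaceP L y z v :
  reflect (exists l0 l1 l2 l3,
      [/\ l0 \in L, l1 \in L, l2 \in L & l3 \in L] /\
      v = quat_comb y z l0 l1 l2 l3)
    ((v : A0) \in comb_space L y z).
Proof.
apply: (iffP idP) => [|[l0 [l1 [l2 [l3 [[L0 L1 L2 L3] ->]]]]]].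
  move=> /memv_addP[? /memv_addP[? /memv_addP[? /memv_imgP[l0 L0 ->]
    [? /memv_imgP[l1 L1 ->] ->]] [? /memv_imgP[l2 L2 ->] ->]]
    [? /memv_imgP[l3 L3 ->] ->]].
  by exists l0, l1, l2, l3; rewrite !lfunE.
have lineE u l : l \in L -> (l *: u : A0) \in (linfun (line_map u) @: L)%VS.
  by move=> Ll; rewrite (_ : l *: u = linfun (line_map u) l) ?memv_img // lfunE.
by rewrite !memv_add ?lineE.
Qed.

Lemma dim_comb_space L y z : (\dim (comb_space L y z) <= 4 * \dim L)%N.
Proof.
have le u : (\dim (linfun (line_map u) @: L) <= \dim L)%N.
  by rewrite -[leqRHS](limg_ker_dim (linfun (line_map u)) L) leq_addl.
have dimD (U V : {vspace A0}) : (\dim (U + V) <= \dim U + \dim V)%N.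
  exact: dimv_add_leqif.
rewrite !mulSn mul0n addn0 !addnA.
by do 3!(apply: leq_trans (dimD _ _) _; apply: leq_add => //).
Qed.

Lemma dim_restrict : \dim {:A0} = (4 * \dim {:K})%N.
Proof. by rewrite dimvf; congr (_ * _)%N; apply: dimvf. Qed.

(** With these norms and traces, left multiplication by y or z acts on coordinates with entries 0, 1
    or trd(z) up to sign, so each letter of a word preserves the space. *)
Lemma generated_sub_comb_space L (S : set A) y z :
  quat_nrd y = 1 -> quat_nrd z = 1 -> quat_trd (y * z) = 0 ->
  quat_trd y = 1 -> 1 \in L -> (forall l, l \in L -> quat_trd z * l \in L) ->
  (forall P : A -> Prop, P 1 -> (forall v, P v -> P (y * v)) ->
     (forall v, P v -> P (z * v)) -> forall v, S v -> P v) ->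
  forall v, S v -> (v : A0) \in comb_space L y z.
Proof.
move=> y1 z1 tyz ty L1 tL; apply.
- apply/comb_spaceP; exists 1, 0, 0, 0; rewrite L1 mem0v; split=> //.
  by rewrite /quat_comb scale1r !scale0r !addr0.
- move=> v /comb_spaceP[l0 [l1 [l2 [l3 [[L0 L1' L2 L3] ->]]]]].
  apply/comb_spaceP.
  rewrite quat_mul_comb1 y1 ty !mul1r; do 4!eexists; split; last by [].
  by rewrite ?memvN !memvD.
move=> v /comb_spaceP[l0 [l1 [l2 [l3 [[L0 L1' L2 L3] ->]]]]].
  apply/comb_spaceP.
rewrite quat_mul_comb2 z1 tyz ty !mul1r !mul0r subr0 addr0; do 4!eexists.
split; last by [].
by split; rewrite ?memvN // ?(memvD, memvB) ?memvN ?tL //.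
Qed.

(** The algebra has rational dimension 4 [K:Q], the space at most 4 dim L. *)
Lemma contains_Qbasis_dim L (S : set A) y z :
  (forall v, S v -> (v : A0) \in comb_space L y z) -> contains_Qbasis S ->
  (\dim {:K} <= \dim L)%N.
Proof.
move=> SW [e [e_basis eS]].
have : (fullv <= comb_space L y z)%VS.
  by rewrite -(span_basis e_basis); apply/span_subvP => v /eS/SW.
move/dimvS => /leq_trans/(_ (dim_comb_space L y z)).
by rewrite dim_restrict leq_pmul2l.
Qed.

Lemma spanning_contains_Qbasis (S : set A) (s : seq A0) :
  (forall v, v \in s -> S v) -> (<<s>> = fullv)%VS -> contains_Qbasis S.
Proof.
move=> sS s_full; have [e [es e_free e_span]] := span_free_seq s.
exists e; split=> [|v /es/sS//]; by rewrite /basis_of e_span s_full eqxx.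
Qed.

Lemma comb_contains_Qbasis (S : set A) y z : S 1 -> S y -> S z ->
  (forall v w, S v -> S w -> S (v * w)) -> S (quat_conj z) ->
  quat_nrd (y * z - z * y) != 0 -> (<<[:: 1%R; quat_trd z]>> = {:K})%VS ->
  contains_Qbasis S.
Proof.
move=> S1 Sy Sz SM Sz' yz_nz K_t.
pose us : seq A := [:: 1; y; z; y * z].
(* Since zu + conj(z) u = trd(z) u, these twelve elements of [S] span u and trd(z) u for each u in
   [us], hence all of Ku. *)
pose s : seq A0 :=
  us ++ [seq z * u | u <- us] ++ [seq quat_conj z * u | u <- us].
have usS u : u \in us -> S u.
  by rewrite !inE => /or4P[]/eqP->; auto.
apply: (@spanning_contains_Qbasis S s) => [v|].
  rewrite !mem_cat => /or3P[/usS//|/mapP[u /usS Su ->]|/mapP[u /usS Su ->]];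
  exact: SM.
have lineP u l : u \in us -> (l *: u : A0) \in <<s>>%VS.
  move=> us_u; have u_s : (u : A0) \in <<s>>%VS.
    by rewrite memv_span // mem_cat us_u.
  have tu_s : (quat_trd z *: u : A0) \in <<s>>%VS.
    rewrite (_ : quat_trd z *: u = z * u + quat_conj z * u).
      by rewrite memvD // memv_span // !mem_cat map_f ?orbT // map_f ?orbT.
    by rewrite -mulrDl quat_trd_conj -scalerAl mul1r.
  have : l \in <<[:: 1%R; quat_trd z]>>%VS by rewrite K_t memvf.
  rewrite span_cons span_seq1.
  move=> /memv_addP[_ /vlineP[p ->] [_ /vlineP[q ->] ->]].
  rewrite scalerDl memvD //; first exact: (memvZ p u_s).
  by rewrite -[q *: _]mulr_algl -scalerA; apply: (memvZ q tu_s).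
apply/eqP; rewrite eqEsubv subvf /=; apply/subvP => v _.
have [l0 [l1 [l2 [l3 ->]]]] := quat_comb_onto v yz_nz.
by rewrite !memvD ?lineP // !inE eqxx ?orbT.
Qed.

End RationalSpan.

(** * The trace of z and the degree of K *)

Section NormOne.
Variables (K : fieldExtType rat) (a b : K).
Hypotheses (a_neq0 : a != 0) (b_neq0 : b != 0).
Variable Lam : set (quat a b).

(** The witness is trd(z). Its equation puts t^2 in the span L of 1 and t, so L is stable under t
    and the L-span of 1, y, z, yz contains the group. *)
Lemma norm_one_trace_field c : c \in [:: 3; 4; 5] ->
  isog_binary_polyhedral c (norm_one Lam) ->
  exists t : K,
    [/\ (if c == 3 then t = 1 else
         if c == 4 then t ^+ 2 = 2%:R else t ^+ 2 = t + 1),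
        (contains_Qbasis (norm_one Lam) ->
           (\dim {:K} <= \dim <<[:: 1%R; t]>>)%N) &
        ((<<[:: 1%R; t]>> = {:K})%VS -> contains_Qbasis (norm_one Lam))].
Proof.
move=> hc isoS; have two_neq0 : (2%:R : K) != 0.
  by have := fmorph_eq0 (in_alg K) (2%:R : rat); rewrite rmorph_nat => ->.
(* For norm 1 the conjugate is the inverse. *)
have S_conj v w : norm_one Lam w -> quat_nrd v = 1 -> v * w = 1 ->
    norm_one Lam (quat_conj v).
  move=> Sw v1 vw; suff -> : quat_conj v = w by [].
  by rewrite -[RHS]mul1r -[1]scale1r -v1 -quat_conj_mul -mulrA vw mulr1.
have S_idem e : norm_one Lam e -> e * e = e -> e = 1.
  move=> [_ e1] ee; rewrite -[LHS]mul1r -[1 * e]scale1r -e1 scalerAl.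
  by rewrite -quat_conj_mul -mulrA ee quat_conj_mul e1 scale1r.
have [y [z [[y3 zc yzC] [S1 Sy Sz SM] Sinv gen]]] :=
  isog_binary_polyhedralP hc S_idem isoS.
have [y1 z1] := (Sy.2, Sz.2).
have [tyz ty tz] := polyhedral_traces two_neq0 a_neq0 b_neq0 hc y1 z1 yzC y3 zc.
have yz_nz := polyhedral_commutator two_neq0 a_neq0 b_neq0 hc y1 z1 yzC y3 zc.
set L := <<[:: 1%R; quat_trd z]>>%VS.
have L1 : 1 \in L by rewrite memv_span ?mem_head.
have Lt : quat_trd z \in L by rewrite memv_span // !inE eqxx orbT.
have Lt2 : quat_trd z ^+ 2 \in L.
  move: tz; case: ifP => _; first by move->; rewrite expr1n.
  by case: ifP => _ ->; rewrite ?memvMn // memvD.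
have tL l : l \in L -> quat_trd z * l \in L.
  rewrite {1}/L span_cons span_seq1 => /memv_addP[_ /vlineP[p ->]].
  case=> _ /vlineP[q ->] ->.
  by rewrite mulrDr -!scalerAr mulr1 -expr2 memvD ?memvZ.
exists (quat_trd z); split=> // [|K_t].
  by apply: contains_Qbasis_dim; apply: generated_sub_comb_space gen.
have [w Sw zw] := Sinv z Sz.
exact: (comb_contains_Qbasis S1 Sy Sz SM (S_conj z w Sw z1 zw)).
Qed.

Lemma tetrahedral_contains_Qbasis :
  isog_binary_tetrahedral (norm_one Lam) ->
  contains_Qbasis (norm_one Lam) <-> \dim {:K} = 1%N.
Proof.
move=> /norm_one_trace_field[//|t [-> bas_le le_bas]].
have span1 : (<<[:: 1%R; 1%R]>> = 1 :> {vspace K})%VS.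
  by rewrite span_cons span_seq1 addvv.
split=> [/bas_le|K1].
  by rewrite span1 dimv1 => le1; apply/eqP; rewrite eqn_leq le1 adim_gt0.
by apply/le_bas/eqP; rewrite span1 eqEdim subvf dimv1 K1.
Qed.

(** Here t is a root of t^2 = 2 or of t^2 = t + 1, hence irrational, so 1 and t span a plane in K.
    The strict bound on the degree rules both groups out over Q. *)
Lemma octa_icosahedral_contains_Qbasis :
  isog_binary_octahedral (norm_one Lam) \/
    isog_binary_icosahedral (norm_one Lam) ->
  (1 < \dim {:K})%N /\
  (contains_Qbasis (norm_one Lam) <-> \dim {:K} = 2%N).
Proof.
move=> oi; have [t [tN bas_le le_bas]] : exists t : K,
    [/\ t \notin 1%VS, (contains_Qbasis (norm_one Lam) ->
           (\dim {:K} <= \dim <<[:: 1%R; t]>>)%N) &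
        ((<<[:: 1%R; t]>> = {:K})%VS -> contains_Qbasis (norm_one Lam))].
  case: oi => /norm_one_trace_field[//|t [/= t2 bas_le le_bas]];
    exists t; split=> //; apply/vlineP => -[r tE]; move: t2; rewrite tE.
  - rewrite -in_algE -rmorphXn /= -(rmorph_nat (in_alg K)).
    move=> /(@fmorph_inj _ _ (in_alg K))/eqP.
    exact/negP/(@rat_sqr_neq_prime 2).
  - rewrite -in_algE -[X in _ = _ + X](rmorph1 (in_alg K)) -rmorphXn.
    rewrite -rmorphD /= => /(@fmorph_inj _ _ (in_alg K)) r2.
    (* Completing the square in r^2 = r + 1 gives (2r - 1)^2 = 5. *)
    have /eqP[] := @rat_sqr_neq_prime 5 (2%:R * r - 1) isT.
    transitivity (4%:R * r ^+ 2 - 4%:R * r + 1); first by ring.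
    by rewrite r2; ring.
have dim_t : \dim <<[:: 1%R; t]>> = 2%N.
  have /eqP/= t_free : free [:: t; 1%R].
    by rewrite free_cons span_seq1 tN seq1_free oner_eq0.
  rewrite -[RHS]t_free; congr (\dim _).
  by apply: eq_span => l; rewrite !inE orbC.
split; first by rewrite -dim_t dimvS ?subvf.
split=> [/bas_le|K2]; last by apply/le_bas/eqP; rewrite eqEdim subvf dim_t K2.
move=> le2; apply/eqP; rewrite eqn_leq -{1}dim_t le2.
by rewrite -dim_t dimvS ?subvf.
Qed.

End NormOne.

Theorem theorem3p2p9 (R : realType) (K : fieldExtType rat) (a b : K)
    (ha : (a != 0)%R) (hb : (b != 0)%R)
    (hA : totally_definite R a b)
    (Lam : set (quat a b)) (hLam : is_order Lam)
    (hexc : isog_binary_tetrahedral (norm_one Lam) \/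
            isog_binary_octahedral (norm_one Lam) \/
            isog_binary_icosahedral (norm_one Lam)) :
  (\dim {:K} = 1%N ->
     (contains_Qbasis (norm_one Lam) <->
      isog_binary_tetrahedral (norm_one Lam))) /\
  (\dim {:K} = 2%N ->
     (contains_Qbasis (norm_one Lam) <->
      (isog_binary_octahedral (norm_one Lam) \/
       isog_binary_icosahedral (norm_one Lam)))) /\
  ((2 < \dim {:K})%N -> ~ contains_Qbasis (norm_one Lam)).
Proof.
have tet := @tetrahedral_contains_Qbasis K a b ha hb Lam.
have octico := @octa_icosahedral_contains_Qbasis K a b ha hb Lam.
split=> [K1|]; last split=> [K2|K3].
- split=> [_|/tet[_]]; last exact.
  (* Degree 1 leaves only the tetrahedral group, the other two forcing a larger degree. *)
  by case: hexc => [//|/octico[]]; rewrite K1.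
- split=> [bas|/octico[_ [_]]]; last exact.
  (* A basis in the tetrahedral case would force degree 1. *)
  by case: hexc => [/tet[/(_ bas)]|//]; rewrite K2.
- by move=> bas; move: K3; case: hexc => [/tet|/octico[_]] [/(_ bas)->].
Qed.
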